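(* Let $A\in \mathbb{C}_{n,m}$ and $D,E \in \mathbb{C}_{m,n}$ be such that $A^{\parallel (D,E)}$ exists. Then the following statements are equivalent. (i) $A A^{\parallel (D,E)} A=A$. (ii) $\mathrm{rk}(A)=\mathrm{rk}(D)$. (iii) $\mathcal{R}(D) \oplus \mathcal{N}(A) = \mathbb{C}^m$. (iv) $\mathcal{R}(A) \oplus \mathcal{N}(E) = \mathbb{C}^n$.
   Context: $\mathbb{C}_{m,n}$ is the set of $m\times n$ complex matrices ($m,n\in\mathbb{N}$). For a matrix $M\in\mathbb{C}_{p,q}$, $\mathcal{R}(M)$ is its column space, $\mathcal{N}(M)=\{\mathbf{x}\in\mathbb{C}^q: M\mathbf{x}=\mathbf{0}\}$ its null space, and $\mathrm{rk}(M)$ its rank. For $A \in \mathbb{C}_{n,m}$ and $D,E \in \mathbb{C}_{m,n}$, $A$ is $(D,E)$-invertible if there exists $X\in\mathbb{C}_{m,n}$ such that $XAD=D$, $EAX=E$, $\mathcal{R}(X)\subseteq\mathcal{R}(D)$ and $\mathcal{N}(E)\subseteq\mathcal{N}(X)$. Such an $X$ is unique if it exists; it is called the $(D,E)$-inverse of $A$ and denoted $A^{\parallel (D,E)}$. *)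

(* Defs.v *)
From HB Require Import structures.
From mathcomp Require Import all_boot all_order all_algebra.
From mathcomp Require Import complex reals.
Set Implicit Arguments.
Unset Strict Implicit.
Unset Printing Implicit Defensive.
Import Order.TTheory GRing.Theory Num.Theory.
Local Open Scope ring_scope.

(* Spaces of column vectors; the %MS theory of mxalgebra is about row spaces. *)
Definition colspace (R : realType) (p q : nat) (M : 'M[R[i]%C]_(p, q)) :
    {vspace 'cV[R[i]%C]_p} :=
  limg (linfun (mulmx M : 'cV[R[i]%C]_q -> 'cV[R[i]%C]_p)).

Definition nullspace (R : realType) (p q : nat) (M : 'M[R[i]%C]_(p, q)) :
    {vspace 'cV[R[i]%C]_q} :=
  lker (linfun (mulmx M : 'cV[R[i]%C]_q -> 'cV[R[i]%C]_p)).

Lemma colspaceP (R : realType) (p q : nat) (M : 'M[R[i]%C]_(p, q))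
    (y : 'cV[R[i]%C]_p) :
  reflect (exists x : 'cV[R[i]%C]_q, y = M *m x) (y \in colspace M).
Proof.
apply: (iffP memv_imgP) => [[x _ ->]|[x ->]]; exists x; rewrite ?memvf ?lfunE //.
Qed.

Lemma nullspaceP (R : realType) (p q : nat) (M : 'M[R[i]%C]_(p, q))
    (x : 'cV[R[i]%C]_q) :
  reflect (M *m x = 0) (x \in nullspace M).
Proof. by rewrite memv_ker lfunE /=; apply: eqP. Qed.

Definition is_DE_inverse (R : realType) (m n : nat)
    (A : 'M[R[i]%C]_(n, m)) (D E : 'M[R[i]%C]_(m, n))
    (X : 'M[R[i]%C]_(m, n)) : bool :=
  [&& X *m A *m D == D, E *m A *m X == E,
      (colspace X <= colspace D)%VS & (nullspace E <= nullspace X)%VS].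

Definition DE_invertible (R : realType) (m n : nat)
    (A : 'M[R[i]%C]_(n, m)) (D E : 'M[R[i]%C]_(m, n)) : Prop :=
  exists X : 'M[R[i]%C]_(m, n), is_DE_inverse A D E X.

Definition DE_inverse (R : realType) (m n : nat)
    (A : 'M[R[i]%C]_(n, m)) (D E : 'M[R[i]%C]_(m, n))
    (h : DE_invertible A D E) : 'M[R[i]%C]_(m, n) :=
  xchoose h.

Lemma DE_inverseP (R : realType) (m n : nat)
    (A : 'M[R[i]%C]_(n, m)) (D E : 'M[R[i]%C]_(m, n))
    (h : DE_invertible A D E) : is_DE_inverse A D E (DE_inverse h).
Proof. exact: xchooseP. Qed.

Lemma is_DE_inverse_uniq (R : realType) (m n : nat)
    (A : 'M[R[i]%C]_(n, m)) (D E X Y : 'M[R[i]%C]_(m, n)) :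
  is_DE_inverse A D E X -> is_DE_inverse A D E Y -> X = Y.
Proof.
case/and4P=> /eqP XAD _ _ /subvP EX /and4P[_ /eqP EAY /subvP YD _].
have eqv (P Q : 'M[R[i]%C]_(m, n)) :
    (forall v : 'cV_n, P *m v = Q *m v) -> P = Q.
  move=> PQ; apply/matrixP => i j.
  by have /matrixP/(_ i 0) := PQ (delta_mx j 0); rewrite -!colE !mxE.
apply: eqv => v; transitivity (X *m A *m Y *m v).
  have: v - A *m Y *m v \in nullspace E.
    by apply/nullspaceP; rewrite mulmxBr !mulmxA EAY subrr.
  by move/EX/nullspaceP; rewrite mulmxBr !mulmxA => /eqP; rewrite subr_eq0 => /eqP.
have /YD/colspaceP[z Yvz] : Y *m v \in colspace Y by apply/colspaceP; exists v.
by rewrite -mulmxA Yvz mulmxA XAD.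
Qed.

(* Main.v *)
Require Import Defs.
From HB Require Import structures.
From mathcomp Require Import all_boot all_order all_algebra.
From mathcomp Require Import complex reals.
Set Implicit Arguments.
Unset Strict Implicit.
Unset Printing Implicit Defensive.
Import Order.TTheory GRing.Theory Num.Theory.
Local Open Scope ring_scope.

(** Write [X] for the [(D, E)]-inverse of [A].  The inclusion of column spaces
    gives [X = D Y], so [X A D = D] yields [X A X = X]: [X] is an outer inverse
    of [A] ([DE_outer_inverse]), and [rk D <= rk A] because [D = X A D].  The
    theorem asks when [X] is also an inner inverse, that is, [A X A = A].

    Ranks.  If [A X A = A] then [rk A <= rk X <= rk D] ([rank_inner_DE]).
    Conversely, equal ranks make the row space of [X A], which lies in that of
    [A], equal to it, and then [A] inherits [A (X A) = A] from the idempotent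
    [X A] ([inner_rank_DE]).

    Complements.  [R(D)] always meets [N(A)] trivially, as [X A] fixes [R(D)]
    and kills [N(A)]; and [R(A) + N(E)] is always everything, as
    [v = A X v + (v - A X v)] with [E A X = E].  So only half of each
    decomposition is at stake.  An inner inverse gives the spanning half of
    the first through [x = X A x + (x - X A x)] ([inner_DE_col_null]); this
    half implies that [R(A)] meets [N(E)] trivially ([col_null_D_E]); and that
    in turn makes [A X A x - A x] vanish, since it lies in both spaces
    ([direct_E_inner]). *)

Section ColumnAndNullSpaces.

Variable R : realType.

Lemma eq_mulmx_col p q (P Q : 'M[R[i]%C]_(p, q)) :
  (forall v : 'cV_q, P *m v = Q *m v) -> P = Q.
Proof.
move=> PQ; apply/matrixP => i j.
by have /matrixP/(_ i 0) := PQ (delta_mx j 0); rewrite -!colE !mxE.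
Qed.

(** Transposing turns this into the factorization through a row space. *)
Lemma colspace_sub_factor p q r (X : 'M[R[i]%C]_(p, q))
    (D : 'M[R[i]%C]_(p, r)) :
  (colspace X <= colspace D)%VS -> exists Y, X = D *m Y.
Proof.
move=> /subvP XD; suff /submxP[Y XY]: (X^T <= D^T)%MS.
  by exists Y^T; rewrite -[X]trmxK XY trmx_mul trmxK.
apply/row_subP => j; rewrite -tr_col colE.
have /XD/colspaceP[z ->] : X *m delta_mx j 0 \in colspace X.
  by apply/colspaceP; exists (delta_mx j 0).
by rewrite trmx_mul submxMl.
Qed.

Lemma directv_col_null p q r (M : 'M[R[i]%C]_(p, q)) (N : 'M[R[i]%C]_(r, p)) :
  directv (colspace M + nullspace N) <->
  (forall y : 'cV_q, N *m (M *m y) = 0 -> M *m y = 0).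
Proof.
split=> [/directv_addP MN0 y NMy0 | MN0].
  apply/eqP; rewrite -memv0 -MN0 memv_cap; apply/andP.
  by split; [apply/colspaceP; exists y | apply/nullspaceP].
apply/directv_addP/eqP; rewrite -subv0; apply/subvP => v.
rewrite memv_cap memv0 => /andP[/colspaceP[y ->] /nullspaceP NMy0].
exact/eqP/MN0.
Qed.

Lemma addv_col_null_full p q r (M : 'M[R[i]%C]_(p, q))
    (N : 'M[R[i]%C]_(r, p)) :
  (colspace M + nullspace N = fullv)%VS <->
  (forall v : 'cV_p, exists y : 'cV_q, N *m (v - M *m y) = 0).
Proof.
split=> [MNf v | MNf].
  have: v \in (colspace M + nullspace N)%VS by rewrite MNf memvf.
  case/memv_addP=> _ /colspaceP[y ->] [w /nullspaceP Nw0 ->].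
  by exists y; rewrite addrC addKr.
apply/eqP; rewrite eqEsubv subvf; apply/subvP => v _.
have [y Ny0] := MNf v; apply/memv_addP.
exists (M *m y); first by apply/colspaceP; exists y.
by exists (v - M *m y); [apply/nullspaceP | rewrite addrC subrK].
Qed.

End ColumnAndNullSpaces.

Section DEInverse.

Variables (R : realType) (m n : nat).
Variables (A : 'M[R[i]%C]_(n, m)) (D E X : 'M[R[i]%C]_(m, n)).
Hypothesis DEX : is_DE_inverse A D E X.

Let XAD : X *m A *m D = D.
Proof. by case/and4P: DEX => /eqP. Qed.

Let EAX : E *m A *m X = E.
Proof. by case/and4P: DEX => _ /eqP. Qed.

Let X_factor : exists Y, X = D *m Y.
Proof. by apply: colspace_sub_factor; case/and4P: DEX. Qed.

Let null_E_X (v : 'cV_n) : E *m v = 0 -> X *m v = 0.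
Proof.
by case/and4P: DEX => _ _ _ /subvP EX /nullspaceP/EX/nullspaceP.
Qed.

(** [X A] fixes the columns of [D], hence those of [X = D Y]. *)
Lemma DE_outer_inverse : X *m A *m X = X.
Proof. by have [Y XY] := X_factor; rewrite {2}XY mulmxA XAD -XY. Qed.

Lemma rank_DE_le : (\rank D <= \rank A)%N.
Proof.
by rewrite -{1}XAD -mulmxA (leq_trans (mxrankM_maxr _ _)) ?mxrankM_maxl.
Qed.

Lemma rank_inner_DE : A *m X *m A = A -> \rank A = \rank D.
Proof.
move=> AXA; apply/eqP; rewrite eqn_leq rank_DE_le andbT.
have [Y XY] := X_factor; rewrite -{1}AXA XY -mulmxA.
apply: leq_trans (mxrankM_maxr _ _) _; rewrite -mulmxA.
exact: mxrankM_maxl.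
Qed.

(** From [D = (X A) D] comes [rk D <= rk (X A) <= rk A], so equality of the
    outer ranks forces [X A] and [A] to have the same row space. *)
Lemma inner_rank_DE : \rank A = \rank D -> A *m X *m A = A.
Proof.
move=> rAD; have XA_le_A : (X *m A <= A)%MS by exact: submxMl.
have rXA : \rank (X *m A) = \rank A.
  apply/eqP; rewrite eqn_leq mxrankM_maxr rAD -{1}XAD.
  exact: mxrankM_maxl.
have /submxP[W AW] : (A <= X *m A)%MS.
  by rewrite -(geq_leqif (mxrank_leqif_sup XA_le_A)) rXA.
by rewrite {1}AW -!mulmxA (mulmxA X) (mulmxA _ X) DE_outer_inverse -AW.
Qed.

Lemma inner_DE_col_null :
  A *m X *m A = A ->
  directv (colspace D + nullspace A) /\ (colspace D + nullspace A)%VS = fullv.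
Proof.
move=> AXA; split.
  by apply/directv_col_null => y ADy0; rewrite -XAD -!mulmxA ADy0 mulmx0.
apply/addv_col_null_full => x; have [Y XY] := X_factor.
exists (Y *m (A *m x)).
by rewrite mulmxA -XY mulmxBr !mulmxA AXA subrr.
Qed.

(** [R(D) + N(A)] being everything means that [R(A)] is already the image of
    [R(D)] under [A]; and [X], which vanishes on [N(E)], is injective on that
    image because [X A D = D]. *)
Lemma col_null_D_E :
  (colspace D + nullspace A)%VS = fullv ->
  directv (colspace A + nullspace E) /\ (colspace A + nullspace E)%VS = fullv.
Proof.
move=> /addv_col_null_full DAf; split.
  apply/directv_col_null => x /null_E_X XAx0; have [y Ay0] := DAf x.
  have Ax : A *m x = A *m (D *m y) by apply/eqP; rewrite -subr_eq0 -mulmxBr Ay0.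
  (* [X A] kills [x], hence its component [D y] along [R(D)], which it fixes. *)
  by rewrite Ax -XAD -!mulmxA -Ax XAx0 mulmx0.
apply/addv_col_null_full => v; exists (X *m v).
by rewrite mulmxBr !mulmxA EAX subrr.
Qed.

(** [E] does not distinguish [A X A x] from [A x], since [E A X = E]; directness
    says that [E] is injective on [R(A)]. *)
Lemma direct_E_inner :
  directv (colspace A + nullspace E) -> A *m X *m A = A.
Proof.
move/directv_col_null => AE0; apply: eq_mulmx_col => x.
apply/eqP; rewrite -subr_eq0 -!mulmxA -mulmxBr; apply/eqP/AE0.
by rewrite !mulmxBr !mulmxA EAX subrr.
Qed.

End DEInverse.

Theorem corollary6p4 (R : realType) (m n : nat)
    (A : 'M[R[i]%C]_(n, m)) (D E : 'M[R[i]%C]_(m, n))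
    (h : DE_invertible A D E) :
  [<-> A *m DE_inverse h *m A = A;
       \rank A = \rank D;
       directv (colspace D + nullspace A) /\
         (colspace D + nullspace A)%VS = fullv;
       directv (colspace A + nullspace E) /\
         (colspace A + nullspace E)%VS = fullv].
Proof.
have DEX := DE_inverseP h; tfae.
- exact: rank_inner_DE DEX.
- by move/(inner_rank_DE DEX); exact: inner_DE_col_null DEX.
- by case=> _; exact: col_null_D_E DEX.
- by case=> AE0 _; exact: direct_E_inner DEX AE0.
Qed.
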